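(* If $\alpha\in\overline{\mathbb{Z}}$ satisfies $4<\langle\alpha,\alpha\rangle$, then $\alpha$ has infinitely many decompositions.
   Context: $\overline{\mathbb{Q}}$ is an algebraic closure of $\mathbb{Q}$ and $\overline{\mathbb{Z}}\subseteq\overline{\mathbb{Q}}$ is the ring of algebraic integers. $\overline{\mathbb{Q}}$ carries the inner product $$\langle\alpha,\beta\rangle=\frac{1}{[\mathbb{Q}(\alpha,\beta):\mathbb{Q}]}\sum_{\sigma:\mathbb{Q}(\alpha,\beta)\to\mathbb{C}}\sigma(\alpha)\cdot\overline{\sigma(\beta)},$$ where the sum ranges over all field embeddings of $\mathbb{Q}(\alpha,\beta)$ in $\mathbb{C}$. A decomposition of $\alpha\in\overline{\mathbb{Z}}$ is a pair $(\beta,\gamma)\in\overline{\mathbb{Z}}^2$ such that $\alpha=\beta+\gamma$ and $\langle\beta,\gamma\rangle\geq 0$. *)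

(* Defs.v *)
From HB Require Import structures.
From mathcomp Require Import all_boot all_order all_algebra all_field.
From mathcomp Require Import all_classical all_reals.
From mathcomp.real_closed Require Import complex.

Set Implicit Arguments.
Unset Strict Implicit.
Unset Printing Implicit Defensive.

Import Order.TTheory GRing.Theory Num.Theory.
Local Open Scope ring_scope.
Local Open Scope classical_set_scope.

(* The algebraic closure of the rationals is algC, and its ring of algebraic
   integers is Aint.  The complex numbers are R[i] for R a realType. *)

(* The number field Q(a, b), with its inclusion into algC and the elements
   that the inclusion maps to a and b (see adjoin2_incl_fst, adjoin2_incl_snd
   and adjoin2_gen). *)
Definition adjoin2 (a b : algC) : fieldExtType rat :=
  projT1 (num_field_exists [:: a; b]).

Definition adjoin2_incl (a b : algC) : {rmorphism adjoin2 a b -> algC} :=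
  projT1 (projT2 (num_field_exists [:: a; b])).

Definition adjoin2_gens (a b : algC) : seq (adjoin2 a b) :=
  s2val (projT2 (projT2 (num_field_exists [:: a; b]))).

Definition adjoin2_fst (a b : algC) : adjoin2 a b := (adjoin2_gens a b)`_0.
Definition adjoin2_snd (a b : algC) : adjoin2 a b := (adjoin2_gens a b)`_1.

Lemma adjoin2_gensE (a b : algC) :
  adjoin2_gens a b = [:: adjoin2_fst a b; adjoin2_snd a b].
Proof.
rewrite /adjoin2_fst /adjoin2_snd.
have := s2valP (projT2 (projT2 (num_field_exists [:: a; b]))).
by rewrite -/(adjoin2_gens a b); case: (adjoin2_gens a b) => [|x [|y []]].
Qed.

Lemma adjoin2_incl_gens (a b : algC) :
  map (adjoin2_incl a b) (adjoin2_gens a b) = [:: a; b].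
Proof. exact: s2valP (projT2 (projT2 (num_field_exists [:: a; b]))). Qed.

Lemma adjoin2_incl_fst (a b : algC) : adjoin2_incl a b (adjoin2_fst a b) = a.
Proof. by have := adjoin2_incl_gens a b; rewrite adjoin2_gensE => -[]. Qed.

Lemma adjoin2_incl_snd (a b : algC) : adjoin2_incl a b (adjoin2_snd a b) = b.
Proof. by have := adjoin2_incl_gens a b; rewrite adjoin2_gensE => -[]. Qed.

Lemma adjoin2_gen (a b : algC) :
  <<1 & [:: adjoin2_fst a b; adjoin2_snd a b]>>%VS = {: adjoin2 a b}%VS.
Proof.
rewrite -adjoin2_gensE.
exact: s2valP' (projT2 (projT2 (num_field_exists [:: a; b]))).
Qed.

Definition embeddings (R : realType) (K : fieldExtType rat) :
    set (K -> R[i]) :=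
  range (fun s : {rmorphism K -> R[i]} => (s : K -> R[i])).
Arguments embeddings : clear implicits.

(* Finiteness matters: a sum \sum_(f \in A) over a set A has junk value 0 when
   infinitely many of its terms are nonzero. *)
Lemma finite_embeddings (R : realType) (K : fieldExtType rat) :
  finite_set (embeddings R K).
Proof.
have roots (a : K) : {rs : seq R[i] |
    forall s : {rmorphism K -> R[i]}, s a \in rs}.
  have /polyOver1P/sig_eqW[p pE] := minPolyOver 1%VS a.
  have p_neq0 : map_poly (ratr : rat -> R[i]) p != 0.
    rewrite map_poly_eq0; apply/eqP => p0.
    by have := monic_minPoly 1%VS a; rewrite pE p0 rmorph0 monicE lead_coef0
      eq_sym oner_eq0.
  have [rs rsE] := closed_field_poly_normal (map_poly (ratr : rat -> R[i]) p).
  exists rs => s; rewrite -root_prod_XsubC.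
  rewrite -(rootZ _ _ (_ : lead_coef (map_poly ratr p) != 0)) ?lead_coef_eq0//.
  rewrite -rsE; have := root_minPoly 1%VS a.
  rewrite pE -(fmorph_root s) -map_poly_comp.
  by rewrite (eq_map_poly (g := ratr)) // => q /=; rewrite alg_num_field fmorph_rat.
pose n := \dim {: K}; pose e := vbasis {: K}.
pose rs := flatten [seq sval (roots e`_(i : 'I_n)) | i <- enum 'I_n].
pose G (t : {ffun 'I_n -> seq_sub rs}) (x : K) : R[i] :=
  \sum_(i < n) ratr (coord e i x) * ssval (t i).
apply: (@sub_finite_set _ _ (range G)); last first.
  exact/finite_image/finite_finset.
move=> _ [s _ <-].
have rsP i : s e`_(i : 'I_n) \in rs.
  apply/flatten_mapP; exists i; first exact: mem_enum.
  exact: svalP (roots e`_i) s.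
exists [ffun i => SeqSub (rsP i)] => //; apply/funext => x; rewrite /G.
rewrite [in RHS](coord_vbasis (memvf x)) rmorph_sum; apply: eq_bigr => i _.
by rewrite ffunE rmorphZ_num.
Qed.

(* The values of the inner product are real, but are kept in R[i].  In the
   partial order of R[i], x <= y (resp. x < y) means that x and y have equal
   imaginary parts and that 'Re x <= 'Re y (resp. 'Re x < 'Re y). *)
Definition inner (R : realType) (a b : algC) : R[i] :=
  (\dim {: adjoin2 a b})%:R^-1 *
  \sum_(f \in embeddings R (adjoin2 a b))
     (f (adjoin2_fst a b) * (f (adjoin2_snd a b))^*%C).

Definition decomposition (R : realType) (a : algC) : set (algC * algC) :=
  [set d | [/\ d.1 \in Aint, d.2 \in Aint, a = d.1 + d.2
             & 0 <= inner R d.1 d.2]].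

(* Main.v *)
From HB Require Import structures.
Require Import Defs.
From mathcomp Require Import all_boot all_order all_algebra all_field.
From mathcomp Require Import all_classical all_reals.
From mathcomp Require Import ring.
From mathcomp.real_closed Require Import complex.

(** For an algebraic integer [b], [(b, alpha - b)] is a decomposition exactly when
    [<b - alpha/2, b - alpha/2> <= <alpha, alpha> / 4]: this is polarization,
    [<b, c> = <b+c, b+c>/4 - <b - (b+c)/2, b - (b+c)/2>].  So the theorem
    asks for infinitely many algebraic integers in a ball around [alpha/2] whose
    radius [r], with [r^2 = <alpha, alpha>/4], exceeds 1.  It is enough that
    [|f b - f alpha / 2| <= r] for every embedding [f] of a number field
    containing [b] and [alpha]; a disc of radius [r > 1] has capacity greater
    than 1, and a Fekete-type argument produces such [b].

    Let [p] be the minimal polynomial of [alpha] and [c = alpha/2].  The [b] are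
    roots of monic polynomials [G] over [Z[alpha]] that are close to
    [(X - c)^N] ([int_near_power]).  When [N = m! 2^m], the coefficients of
    [X^N, ..., X^(N-m)] in [(X - c)^N] already lie in [Z[alpha]]
    ([dvdn_bin_fact]); the lower ones are rounded from the top down, by adding
    [e_i (X - c)^i] for [i < N - m], where [e_i] is a combination of
    [1, alpha, ..., alpha^(deg p)] with coefficients between 0 and 1
    ([round_poly]).  Everything is written with bivariate polynomials over the
    rationals modulo [p], so the result holds at all the conjugates [z] of
    [alpha] at once, and every [e_i(z)] is bounded by a constant independent of
    [m].  If [G(z, w)] is a bounded constant and [t = |w - z/2|], then
    [t^N <= B (1 + t + ... + t^(N-m-1))], and for [m] large this forces [t <= r]
    ([geometric_le], [root_location]).

    Given a finite set [L], one of the equations [G(alpha, b) = k] with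
    [0 <= k <= |L|] has no solution in [L], since each [b] in [L] solves at most
    one of them.  Any solution of it is a new algebraic integer near
    [alpha/2] ([exists_near_half]).

    It remains to compare [inner] on the field of [(b, alpha - b)] with [inner]
    on the field of [(alpha, alpha)]: the average of [G (f a)] over the
    embeddings [f] of a number field containing [a] is the average of [G] over
    the complex roots of the minimal polynomial of [a]
    ([embedding_average]). *)

Set Implicit Arguments.
Unset Strict Implicit.
Unset Printing Implicit Defensive.

Import Order.TTheory GRing.Theory Num.Theory.
Local Open Scope ring_scope.

(** * Embeddings of a number field *)

Section Embeddings.

Variables (K : fieldExtType rat) (C : numClosedFieldType).
Implicit Types (f g : {rmorphism K -> C}) (a x : K) (p q : {poly rat}).

Lemma rmorph_horner_rat f q x :
  f (map_poly (in_alg K) q).[x] = (map_poly ratr q).[f x].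
Proof.
rewrite -horner_map -map_poly_comp.
rewrite (eq_map_poly (g := ratr)) // => c /=.
by rewrite alg_num_field fmorph_rat.
Qed.

Lemma minPoly_ratP a : {p : {poly rat} | p \is monic &
  map_poly (in_alg K) p = minPoly 1 a}.
Proof.
have /polyOver1P/sig_eqW[p pE] := minPolyOver 1%VS a.
by exists p => //; rewrite -(map_monic (in_alg K)) -pE monic_minPoly.
Qed.

Lemma root_minPoly_rat a p q : map_poly (in_alg K) p = minPoly 1 a ->
  root (map_poly (in_alg K) q) a = (p %| q).
Proof.
move=> pE; apply/idP/idP => [qa|/dvdpP[u ->]]; last first.
  by rewrite rmorphM rootM /= pE root_minPoly orbT.
rewrite -(dvdp_map (in_alg K)) /= pE minPoly_dvdp //.
by apply/polyOver1P; exists q.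
Qed.

Lemma size_minPoly_rat a p : map_poly (in_alg K) p = minPoly 1 a ->
  size p = (\dim <<1; a>>%VS).+1.
Proof.
by move=> pE; rewrite -(size_map_poly (in_alg K)) /= pE size_minPoly dim_Fadjoin
  dimv1 muln1.
Qed.

Lemma minPoly_rat_separable a p : map_poly (in_alg K) p = minPoly 1 a ->
  separable_poly p.
Proof.
move=> pE; rewrite -(separable_map (in_alg K)) /= pE.
by apply: pcharf0_separable => l; rewrite pchar_lalg pchar_num.
Qed.

Lemma primitive_element : {t : K | <<1; t>>%VS = fullv}.
Proof.
exists (separable_generator 1 {:K}%AS).
rewrite -eq_adjoin_separable_generator ?sub1v //.
apply/separableP => y _; apply: pcharf0_separable => l.
by rewrite pchar_lalg pchar_num.
Qed.

Lemma adjoin_ratP a x : x \in <<1; a>>%VS ->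
  {q : {poly rat} | x = (map_poly (in_alg K) q).[a]}.
Proof.
move=> xa; have /polyOver1P/sig_eqW[q qE] := Fadjoin_polyOver 1 a x.
by exists q; rewrite -qE Fadjoin_poly_eq.
Qed.

(** Elements of [K] are values [q(t)] of rational polynomials, and two
    polynomials with the same value at [t] differ by a multiple of [p], which
    vanishes at [z]; hence [q(t) |-> q(z)] is a well-defined morphism. *)
Lemma embedding_exists (t : K) p z : <<1; t>>%VS = fullv ->
  map_poly (in_alg K) p = minPoly 1 t -> root (map_poly ratr p) z ->
  exists f : {rmorphism K -> C}, f t = z.
Proof.
move=> tK pE pz.
have wit x : {q : {poly rat} | x = (map_poly (in_alg K) q).[t]}.
  by apply: adjoin_ratP; rewrite tK memvf.
pose h x := (map_poly ratr (sval (wit x))).[z] : C.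
have hE q : h (map_poly (in_alg K) q).[t] = (map_poly ratr q).[z].
  rewrite /h; case: (wit _) => r /= qr; apply/eqP.
  rewrite -subr_eq0 -hornerN -hornerD -rmorphB /=.
  have /dvdpP[u ->] : p %| r - q.
    by rewrite -(root_minPoly_rat _ pE) rootE rmorphB hornerD hornerN -qr subrr.
  by rewrite rmorphM /= -rootE rootM pz orbT.
have hB : zmod_morphism h.
  move=> x y; have [q ->] := wit x; have [r ->] := wit y.
  by rewrite -hornerN -hornerD -rmorphB !hE rmorphB hornerD hornerN.
have hM : monoid_morphism h.
  split=> [|x y].
    by have := hE 1%:P; rewrite !map_polyC !hornerC /= scale1r rmorph1.
  have [q ->] := wit x; have [r ->] := wit y.
  by rewrite -hornerM -rmorphM !hE rmorphM hornerM.
pose hm1 := GRing.isZmodMorphism.Build K C h hB.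
pose hm2 := GRing.isMonoidMorphism.Build K C h hM.
pose H : {rmorphism K -> C} := HB.pack h hm1 hm2.
exists H; rewrite /H /=.
by rewrite -[in LHS](hornerX t) -(map_polyX (in_alg K)) hE map_polyX hornerX.
Qed.

Lemma eq_on_primitive (t : K) f g : <<1; t>>%VS = fullv -> f t = g t -> f =1 g.
Proof.
move=> tK fg x; have [|q ->] := @adjoin_ratP t x; first by rewrite tK memvf.
by rewrite !rmorph_horner_rat fg.
Qed.

End Embeddings.

(** The fibers of [h] over [r] have [m * size r] elements in total and at most
    [m] each, so each of them has exactly [m]. *)
Lemma sum_uniform_fibers (T U : eqType) (V : nmodType) (s : seq T) (r : seq U)
    (h : T -> U) (m : nat) (G : U -> V) :
    uniq r -> {in s, forall x, h x \in r} ->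
    (forall z, count (fun x => h x == z) s <= m)%N ->
    size s = (m * size r)%N ->
  \sum_(x <- s) G (h x) = (\sum_(z <- r) G z) *+ m.
Proof.
move=> ur hr cm sz.
have sumE (W : nmodType) (H : U -> W) :
    \sum_(x <- s) H (h x) = \sum_(z <- r) H z *+ count (fun x => h x == z) s.
  rewrite big_seq (eq_bigr (fun x => \sum_(z <- r | h x == z) H z)); last first.
    move=> x xs; rewrite big_mkcond (bigD1_seq (h x)) ?hr //= eqxx.
    by rewrite big1 ?addr0 // => z /negPf; rewrite eq_sym => ->.
  rewrite -big_seq (exchange_big_dep predT) //=; apply: eq_bigr => z _.
  by rewrite big_const_seq iter_addr addr0.
have cE : {in r, forall z, count (fun x => h x == z) s = m}.
  have szE : (m * size r)%N = (\sum_(z <- r) count (fun x => h x == z) s)%N.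
    rewrite -sz -sum1_size (sumE nat (fun=> 1%N)).
    by apply: eq_bigr => z _; exact: natn.
  have : (\sum_(z <- r) (m - count (fun x => h x == z) s))%N == 0%N.
    rewrite -(eqn_add2l (m * size r)) addn0 {1}szE -big_split /=.
    under eq_bigr => z _ do rewrite subnKC //.
    by rewrite big_const_seq count_predT iter_addn_0.
  rewrite sum_nat_seq_eq0 => /allP al z zr.
  by apply/eqP; rewrite eqn_leq cm /= -subn_eq0; exact: al zr.
rewrite sumE -sumrMnl big_seq [RHS]big_seq.
by apply: eq_bigr => z zr; rewrite cE.
Qed.

Section EmbeddingSums.

Variables (R : realType) (K : fieldExtType rat).

(** An embedding is determined by the image of a primitive element, which can
    be any root of its minimal polynomial; in characteristic 0 the number of
    these roots is the degree. *)
Lemma embeddings_enum : exists s : seq (K -> R[i]),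
  [/\ uniq s, size s = \dim {: K} & [set` s] = embeddings R K]%classic.
Proof.
have [t tK] := primitive_element K.
have [p p_monic pE] := minPoly_ratP t.
have [rs] := closed_field_poly_normal (map_poly (ratr : rat -> R[i]) p).
rewrite (monicP _) ?map_monic // scale1r => rsE.
have urs : uniq rs.
  rewrite -separable_prod_XsubC -rsE separable_map.
  exact: minPoly_rat_separable pE.
have root_rs z : (z \in rs) = root (map_poly ratr p) z.
  by rewrite rsE root_prod_XsubC.
have [h hE] : {h : R[i] -> K -> R[i] & forall z, z \in rs ->
    embeddings R K (h z) /\ h z t = z}.
  apply: (@choice _ _ (fun z g =>
    z \in rs -> embeddings R K g /\ g t = z)) => z.
  have [zrs|] := boolP (z \in rs); last by exists (fun=> 0).
  rewrite root_rs in zrs; have [f fz] := embedding_exists tK pE zrs.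
  by exists f => _; split=> //; exists f.
exists (map h rs); split.
- apply: (map_uniq (f := fun g : K -> R[i] => g t)).
  rewrite -map_comp (eq_in_map _ id _).1 ?map_id // => z zrs /=.
  by have [_ ->] := hE z zrs.
- apply: succn_inj; rewrite size_map -tK -(size_minPoly_rat pE).
  by rewrite -(size_map_poly (ratr : rat -> R[i]) p) rsE size_prod_XsubC.
- apply/seteqP; split=> [_ /mapP[z zrs ->]|_ [f _ <-]].
    by have [] := hE z zrs.
  have ft : f t \in rs.
    by rewrite root_rs rootE -rmorph_horner_rat pE minPolyxx rmorph0.
  apply/mapP; exists (f t) => //; apply/funext.
  by have [[g _ <-] gt] := hE _ ft; exact: eq_on_primitive tK _.
Qed.

(** Embeddings with the same value at [a] agree on [Q(a)], so they send a
    primitive element [t] to roots of one and the same polynomial: the image of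
    the minimal polynomial of [t] over [Q(a)], of degree [[K : Q(a)]]. *)
Lemma fiber_size_le (a : K) (z : R[i]) (s : seq (K -> R[i])) : uniq s ->
    (forall g, g \in s -> embeddings R K g /\ g a = z) ->
  (size s <= \dim {: K} %/ \dim <<1; a>>%VS)%N.
Proof.
have [t tK] := primitive_element K.
have -> : (\dim {: K} %/ \dim <<1; a>>%VS)%N = adjoin_degree <<1; a>>%AS t.
  rewrite adjoin_degreeE; congr (\dim _ %/ _)%N; apply/esym/eqP.
  by rewrite eqEsubv subvf -{1}tK adjoinSl // sub1v.
case: s => [//|f0 s] us sE.
have [[f _ fE] fa] := sE f0 (mem_head _ _).
rewrite -ltnS -size_minPoly -(size_map_poly f).
rewrite -(size_map (fun g : K -> R[i] => g t)) max_poly_roots //.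
- by rewrite map_poly_eq0 monic_neq0 // monic_minPoly.
- apply/allP => _ /mapP[g gs ->]; have [[k _ <-] ka] := sE g gs.
  have <- : map_poly k (minPoly <<1; a>> t) = map_poly f (minPoly <<1; a>> t).
    apply/polyP => i; rewrite !coef_map /=.
    have /polyOverP/(_ i)/adjoin_ratP[q ->] := minPolyOver <<1; a>>%VS t.
    by rewrite !rmorph_horner_rat ka fE fa.
  by rewrite fmorph_root root_minPoly.
- rewrite map_inj_in_uniq // => g1 g2 /sE[[k1 _ <-] _] /sE[[k2 _ <-] _] k12.
  by apply/funext; exact: eq_on_primitive tK k12.
Qed.

(** [f |-> f a] maps the [[K : Q]] embeddings to the [[Q(a) : Q]] roots of [p],
    and its fibers have at most [[K : Q(a)]] elements: [sum_uniform_fibers]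
    applies.  In particular the average does not depend on [K]. *)
Lemma embedding_average (a : K) (p : {poly rat}) (rs : seq R[i])
    (G : R[i] -> R[i]) :
    map_poly (in_alg K) p = minPoly 1 a ->
    map_poly ratr p = \prod_(z <- rs) ('X - z%:P) ->
  (\dim {: K})%:R^-1 * \sum_(f \in embeddings R K) G (f a) =
  (size rs)%:R^-1 * \sum_(z <- rs) G z.
Proof.
move=> pE rsE; have [s [us szs sE]] := embeddings_enum.
have embP g : g \in s -> embeddings R K g by rewrite -sE.
have szrs : size rs = \dim <<1; a>>%VS.
  apply: succn_inj; rewrite -(size_minPoly_rat pE).
  by rewrite -(size_map_poly (ratr : rat -> R[i]) p) rsE size_prod_XsubC.
pose m := (\dim {: K} %/ size rs)%N.
have dimE : \dim {: K} = (m * size rs)%N.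
  by rewrite divnK // szrs field_dimS // subvf.
have K_gt0 : (0 < \dim {: K})%N by rewrite adim_gt0.
have m_neq0 : m%:R != 0 :> R[i].
  by rewrite pnatr_eq0 -lt0n; move: K_gt0; rewrite dimE muln_gt0 => /andP[].
rewrite -sE -fsbig_seq //.
rewrite (@sum_uniform_fibers _ _ _ s rs (fun f => f a) m) ?szs //.
- by rewrite dimE natrM invfM -[X in _ * X]mulr_natl mulrACA mulVf ?mul1r.
- rewrite -separable_prod_XsubC -rsE separable_map.
  exact: minPoly_rat_separable pE.
- move=> _ /embP[f _ <-]; rewrite -root_prod_XsubC -rsE rootE.
  by rewrite -rmorph_horner_rat pE minPolyxx rmorph0.
move=> z; rewrite -size_filter /m szrs; apply: (@fiber_size_le a z).
  exact: filter_uniq.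
by move=> g; rewrite mem_filter => /andP[/eqP <- /embP].
Qed.

End EmbeddingSums.

(** * Integral polynomials close to a power of a linear one *)

Section Rounding.

Variable p : {poly rat}.
Hypothesis p_monic : p \is monic.

(** The remainders allowed in rounding modulo [p]; their values at the roots of
    [p] are bounded in terms of [p] alone. *)
Definition unit_coefs (e : {poly rat}) :=
  (size e <= size p)%N /\ forall i, 0 <= e`_i <= 1.

Lemma round_coef (q : {poly rat}) : exists g e : {poly rat},
  [/\ forall l, g`_l \is a Num.int, unit_coefs e & p %| q + e - g].
Proof.
pose u := q %% p; pose g : {poly rat} := \poly_(i < size u) (Num.ceil u`_i)%:~R.
have p0 := monic_neq0 p_monic.
have gE i : g`_i = (Num.ceil u`_i)%:~R.
  rewrite coef_poly; case: ltnP => // /(nth_default 0) ->.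
  by rewrite ceil0.
exists g, (g - u); split.
- by move=> i; rewrite gE intr_int.
- split=> [|i]; last first.
    rewrite coefB gE subr_ge0 ceil_ge /=.
    rewrite lerBlDl -lerBlDr ltW //.
    by have := ceilB1_lt u`_i; rewrite rmorphB.
  rewrite (leq_trans (size_polyD _ _)) // geq_max size_polyN.
  rewrite andbC ltnW ?ltn_modp //=; apply: leq_trans (size_poly _ _) _.
  by rewrite ltnW ?ltn_modp.
by rewrite addrA addrAC addrK /u {1}(divp_eq q p) addrK dvdp_mull.
Qed.

(** A polynomial [G] over [{poly rat}] stands for one over [Q(alpha)], equality
    being divisibility of the coefficients by [p].  Adding a multiple of
    [('X - c)^k] makes the coefficient of degree [k] integral and changes only
    lower ones, which are treated afterwards: hence the descent on [k].
    Corrections by multiples of ['X^k] would have size [|w|^k], which powers of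
    [|w - c|] need not control. *)
Lemma round_poly (c : {poly rat}) (k : nat) (P : {poly {poly rat}}) :
  (size P <= k)%N -> exists (G : {poly {poly rat}}) (e : nat -> {poly rat}),
  [/\ forall j l, G`_j`_l \is a Num.int, (size G <= k)%N,
      forall i, unit_coefs (e i)
    & forall j, p %| (P + \sum_(i < k) e i *: ('X - c%:P) ^+ i - G)`_j].
Proof.
elim: k P => [|k IH] P szP.
  exists 0, (fun=> 0); split; rewrite ?size_poly0 //.
    by move=> j l; rewrite !coef0.
    by move=> i; split=> [|j]; rewrite ?size_poly0 ?coef0.
  move=> j; rewrite big_ord0 addr0 subr0.
  by rewrite nth_default ?dvdp0 // (leq_trans szP).
have [g [e [g_int eB]]] := round_coef P`_k.
set r := P`_k + e - g => p_r.
(* What remains of [P] once its rounded coefficient of degree [k] is removed;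
   the term in [r] is zero modulo [p]. *)
pose P' := P + e *: ('X - c%:P) ^+ k - g *: 'X^k - r *: 'X^k.
have szP' : (size P' <= k)%N.
  apply/leq_sizeP => j; rewrite leq_eqVlt => /predU1P[<-|kj].
    rewrite !coefB coefD !coefZ coefXn eqxx !mulr1.
    have -> : (('X - c%:P) ^+ k)`_k = 1.
      have /monicP : ('X - c%:P) ^+ k \is monic.
        by rewrite monic_exp ?monicXsubC.
      by rewrite lead_coefE size_exp_XsubC.
    by rewrite mulr1 subrr.
  rewrite !coefB coefD !coefZ coefXn gtn_eqF // !mulr0 !subr0.
  rewrite (nth_default _ (leq_trans szP kj)) add0r nth_default ?mulr0 //.
  by rewrite size_exp_XsubC.
have [G [e' [G_int szG e'B GE]]] := IH P' szP'.
exists (G + g *: 'X^k), (fun i => if i == k then e else e' i); split.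
- move=> j l; rewrite coefD coefZ coefXn mulr_natr coefD coefMn.
  by rewrite rpredD // rpredMn.
- rewrite (leq_trans (size_polyD _ _)) // geq_max (leq_trans szG) //=.
  by rewrite (leq_trans (size_scale_leq _ _)) // size_polyXn.
- by move=> i; case: ifP.
move=> j; rewrite big_ord_recr /= eqxx.
rewrite (eq_bigr (fun i : 'I_k => e' i *: ('X - c%:P) ^+ i)); last first.
  by move=> i _; rewrite ltn_eqF.
set S := \sum_(i < k) _ in GE *.
have -> : P + (S + e *: ('X - c%:P) ^+ k) - (G + g *: 'X^k) =
  (P' + S - G) + r *: 'X^k.
  by rewrite /P'; ring.
by rewrite coefD coefZ dvdp_add ?GE // dvdp_mulr.
Qed.

(** From [i C(N, i) = N C(N-1, i-1)], since [i] divides [m!]: it leaves the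
    factor [d^m] of [N] intact. *)
Lemma dvdn_bin_fact (m d i : nat) : (i <= m)%N ->
  (d ^ i %| 'C(m`! * d ^ m, i))%N.
Proof.
case: i => [|i] im; first by rewrite bin0.
have /dvdnP[q qE] : (i.+1 %| m`!)%N by apply: dvdn_fact.
have := mul_bin_diag (m`! * d ^ m) i; set N := (_ * d ^ m)%N.
rewrite {1}/N qE => /esym /eqP; rewrite -!mulnA mulnCA eqn_pmul2l // => /eqP ->.
by rewrite dvdn_mull // dvdn_mulr // dvdn_exp2l.
Qed.

Definition half_X : {poly rat} := 2^-1 *: 'X.

(** The exponent [m! 2^m] makes the [m + 1] top coefficients of
    [('X - half_X)^N] integral, so that only the terms of degree less than
    [N - m] need rounding. *)
Lemma int_near_power (m : nat) :
  exists (N : nat) (G : {poly {poly rat}}) (e : nat -> {poly rat}),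
  [/\ (m < N)%N, G \is monic, size G = N.+1,
      forall j l, G`_j`_l \is a Num.int
    & (forall i, unit_coefs (e i)) /\
      forall j, p %| (('X - half_X%:P) ^+ N
        + \sum_(i < N - m) e i *: ('X - half_X%:P) ^+ i - G)`_j].
Proof.
pose N := (m`! * 2 ^ m)%N.
have mN : (m < N)%N.
  apply: leq_trans (ltn_expl m (isT : 1 < 2)%N) _.
  by rewrite leq_pmull // fact_gt0.
set Y := 'X - half_X%:P.
have YN : Y ^+ N \is monic by rewrite monic_exp ?monicXsubC.
have szY : size (Y ^+ N) = N.+1 by rewrite size_exp_XsubC.
pose P := \poly_(j < N - m) (Y ^+ N)`_j.
have szP : (size P <= N - m)%N by exact: size_poly.
have [G [e [G_int szG eB GE]]] := round_poly half_X szP.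
have topE j : (Y ^+ N)`_j = ((- half_X) ^+ (N - j)) *+ 'C(N, j).
  rewrite /Y -polyCN addrC exprDn.
  pose b i := (- half_X) ^+ (N - i) *+ 'C(N, i).
  rewrite (eq_bigr (fun i : 'I_N.+1 => b i *: 'X^i)).
    rewrite -poly_def coef_poly /b.
    by case: ltnP => // Nj; rewrite bin_small.
  by move=> i _; rewrite -polyC_exp mul_polyC /b scalerMnl.
have szPG : (size (G - P)%R < size (Y ^+ N)%R)%N.
  rewrite szY ltnS (leq_trans (size_polyD _ _)) // size_polyN geq_max.
  by rewrite !(leq_trans _ (leq_subr m N)).
exists N, (Y ^+ N + (G - P)), e; split=> //.
- by rewrite monicE lead_coefDl.
- by rewrite size_polyDl.
- move=> j l; rewrite addrCA coefD coefB coef_poly topE.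
  rewrite coefD rpredD //; case: ltnP => [_|jN]; first by rewrite subrr coef0.
  have [Nj|jN'] := ltnP N j; first by rewrite bin_small // mulr0n subr0 coef0.
  rewrite subr0 -bin_sub //.
  have /(dvdn_bin_fact 2)/dvdnP[q ->] : (N - j <= m)%N by rewrite leq_subCl.
  rewrite /half_X -scaleNr exprZn coefMn coefZ coefXn -mulrnAl mulnC mulrnA.
  have -> : (- 2^-1) ^+ (N - j) *+ 2 ^ (N - j) = (-1) ^+ (N - j) :> rat.
    by rewrite -mulr_natr natrX -exprMn mulNr mulVf.
  by rewrite rpredM ?rpredMn ?rpredX ?rpredN1 ?rpred_nat.
split=> // j; move: (GE j); set S := \sum_(i < N - m) _.
have -> // : P + S - G = Y ^+ N + S - (Y ^+ N + (G - P)) by ring.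
Qed.

End Rounding.

(** * Location of the roots *)

Section RootLocation.

Variable C : numClosedFieldType.

(** If [t > r], summing the geometric series gives
    [t^N (t - 1) < B t^(N-m)], that is [t^m (t - 1) < B <= r^m (r - 1)]. *)
Lemma geometric_le (r B t : C) (m N : nat) : 1 < r -> 0 <= B -> 0 <= t ->
    (m <= N)%N -> B <= r ^+ m * (r - 1) ->
    t ^+ N <= B * \sum_(i < N - m) t ^+ i -> t <= r.
Proof.
move=> r1 B0 t0 mN Br tN.
rewrite real_leNgt ?ger0_real ?(ltW (lt_trans ltr01 r1)) //; apply/negP => rt.
have t1 : 1 < t := lt_trans r1 rt.
have r0 : 0 < r := lt_trans ltr01 r1.
have tp : 0 < t := lt_trans ltr01 t1.
have : t ^+ N * (t - 1) <= B * t ^+ (N - m).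
  apply: le_trans (_ : B * (\sum_(i < N - m) t ^+ i) * (t - 1) <= _).
    by rewrite ler_wpM2r // subr_ge0 ltW.
  rewrite -mulrA [X in B * X]mulrC -subrX1 ler_wpM2l //.
  by rewrite gerBl ler01.
rewrite -{1}(subnK mN) exprD -mulrA mulrC ler_pM2r ?exprn_gt0 //.
apply/negP; rewrite -real_ltNge; last 2 first.
- by rewrite ger0_real.
- by rewrite ger0_real // mulr_ge0 ?exprn_ge0 ?subr_ge0 ?ltW.
apply: le_lt_trans Br _.
apply: (@le_lt_trans _ _ (t ^+ m * (r - 1))).
  by rewrite ler_wpM2r ?subr_ge0 ?(ltW r1) // lerXn2r ?nnegrE ?ltW.
by rewrite ltr_pM2l ?exprn_gt0 // ltrD2r.
Qed.

Lemma unit_coefs_norm (p e : {poly rat}) (z : C) : unit_coefs p e ->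
  `|(map_poly ratr e).[z]| <= \sum_(i < size p) `|z| ^+ i.
Proof.
move=> [sze e01]; rewrite (@horner_coef_wide _ (size p)) ?size_map_poly //.
apply: le_trans (ler_norm_sum _ _ _) _; apply: ler_sum => i _.
rewrite coef_map normrM normrX ler_piMl ?exprn_ge0 //=.
have /andP[e0 e1] := e01 i.
by rewrite ger0_norm ?ler0q // -(rmorph1 (@ratr C)) ler_rat.
Qed.

(** The morphism [Q[A] -> C] with [A |-> z]; applied to coefficients it
    specializes a polynomial over [Q[A]] at a conjugate of [alpha]. *)
Definition eval_at (z : C) : {poly rat} -> C := horner_eval z \o map_poly ratr.

HB.instance Definition _ (z : C) :=
  GRing.RMorphism.copy (eval_at z) (horner_eval z \o map_poly ratr).

(** At [A = z] and ['X = w], the congruence modulo [p] reads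
    [t^N + \sum_i e_i(z) t^i = k] for [t = w - z/2]. *)
Lemma root_location (p : {poly rat}) (m N k : nat) (G : {poly {poly rat}})
    (e : nat -> {poly rat}) (r z w : C) :
    (m < N)%N -> (forall i, unit_coefs p (e i)) ->
    (forall j, p %| (('X - half_X%:P) ^+ N
       + \sum_(i < N - m) e i *: ('X - half_X%:P) ^+ i - G)`_j) ->
    root (map_poly ratr p) z ->
    1 < r -> \sum_(i < size p) `|z| ^+ i + k%:R <= r ^+ m * (r - 1) ->
    (map_poly (eval_at z) G).[w] = k%:R ->
  `|w - z / 2| <= r.
Proof.
move=> mN eB pG pz r1 Br Gw; set t := w - z / 2.
set B0 := \sum_(i < size p) `|z| ^+ i in Br.
have B0_ge0 : 0 <= B0 by rewrite sumr_ge0 // => i _; rewrite exprn_ge0.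
have tE : t ^+ N + \sum_(i < N - m) (map_poly ratr (e i)).[z] * t ^+ i = k%:R.
  rewrite -Gw; apply/eqP; rewrite -subr_eq0.
  set U := ('X - half_X%:P) ^+ N + _ - G in pG.
  have : (map_poly (eval_at z) U).[w] = 0.
    rewrite (_ : map_poly _ U = 0) ?horner0 //; apply/polyP => j.
    rewrite coef0 coef_map /= /eval_at /= /horner_eval.
    have /dvdpP[q ->] := pG j.
    by rewrite rmorphM /= hornerM (rootP pz) mulr0.
  rewrite rmorphB rmorphD rmorphXn rmorph_sum hornerD hornerN hornerD.
  have YE : map_poly (eval_at z) ('X - half_X%:P) = 'X - (z / 2)%:P.
    rewrite rmorphB /= map_polyX map_polyC /= /eval_at /= /horner_eval.
    rewrite /half_X map_polyZ /= map_polyX hornerZ hornerX.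
    by rewrite fmorphV rmorph_nat mulrC.
  rewrite /= YE horner_exp hornerXsubC -/t horner_sum => U0.
  rewrite -[X in _ == X]U0; apply/eqP; congr (_ + _ - _); apply: eq_bigr => i _.
  by rewrite map_polyZ rmorphXn /= YE hornerZ horner_exp hornerXsubC.
apply: (@geometric_le r (B0 + k%:R) `|t| m N) => //.
- by rewrite addr_ge0.
- exact: ltnW.
have -> : `|t| ^+ N =
    `|k%:R - \sum_(i < N - m) (map_poly ratr (e i)).[z] * t ^+ i|.
  by rewrite -tE addrK normrX.
apply: le_trans (ler_normB _ _) _; rewrite addrC mulrDl lerD //.
  rewrite mulr_sumr; apply: le_trans (ler_norm_sum _ _ _) _.
  apply: ler_sum => i _; rewrite normrM normrX ler_wpM2r ?exprn_ge0 //.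
  exact: unit_coefs_norm.
(* The sum over [i < N - m] is nonempty and its first term is 1. *)
rewrite normr_nat ler_peMr //; move: mN; rewrite -subn_gt0.
case: (N - m)%N => // l _; rewrite big_ord_recl expr0 lerDl sumr_ge0 // => i _.
by rewrite exprn_ge0.
Qed.

End RootLocation.

Lemma power_unbounded (R : realType) (r B : R[i]) : 1 < r -> 0 <= B ->
  exists m, B <= r ^+ m * (r - 1).
Proof.
move=> r1 B0.
have r_real : r \is Num.real by rewrite ger0_real // ltW // (lt_trans ltr01).
have B_real : B \is Num.real by rewrite ger0_real.
have [s sE] := complex_realP r r_real.
have [b bE] := complex_realP B B_real.
have s1 : 1 < s by move: r1; rewrite sE -ltcR.
have bern m : 1 + m%:R * (s - 1) <= s ^+ m.
  elim: m => [|m IH]; first by rewrite mul0r addr0.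
  rewrite exprS; apply: (@le_trans _ _ (s * (1 + m%:R * (s - 1)))).
    rewrite -natr1 -subr_ge0.
    have -> : s * (1 + m%:R * (s - 1)) - (1 + (m%:R + 1) * (s - 1)) =
      m%:R * (s - 1) ^+ 2 by ring.
    by rewrite mulr_ge0 // exprn_ge0 // subr_ge0 ltW.
  by rewrite ler_wpM2l // ltW // (lt_trans ltr01).
have s1_gt0 : 0 < s - 1 by rewrite subr_gt0.
exists (Num.bound (b / (s - 1) / (s - 1))).
set m := Num.bound _.
have : b / (s - 1) / (s - 1) < m%:R.
  by rewrite archi_boundP // !(divr_ge0 _ (ltW s1_gt0)) // -ler0c -bE.
rewrite ltr_pdivrMr // => bm.
rewrite sE bE -rmorphXn -(rmorph1 (real_complex R)) -rmorphB -rmorphM /= lecR.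
rewrite -ler_pdivrMr // (le_trans (ltW bm)) // (le_trans _ (bern m)) //.
by rewrite lerDr ler01.
Qed.

(** * Algebraic integers near half of a given one *)

Lemma Aint_integral (x : algC) :
  x \in Aint <-> integralOver (intr : int -> algC) x.
Proof.
split=> [xA|[q q_monic qx]].
  have /floorpP[q qE] := xA; exists q; last by rewrite -qE root_minCpoly.
  have := minCpoly_monic x; rewrite qE !monicE lead_coef_map_inj ?rmorph0 //.
    by rewrite -(eqr_int algC).
  exact: intr_inj.
apply: root_monic_Aint qx _ _; first exact: monic_map.
by apply/polyOverP => i; rewrite coef_map intr_int.
Qed.

Lemma root_monic_over_Aint (F : {poly algC}) (x : algC) :
  F \is monic -> (forall i, F`_i \in Aint) -> root F x -> x \in Aint.
Proof.
move=> F_monic F_int Fx; apply/Aint_integral.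
apply: integral_root_monic F_monic Fx _.
by apply/integral_poly => i; apply/Aint_integral.
Qed.

Lemma rmorph_eval_at (K : fieldExtType rat) (C : numClosedFieldType)
    (f : {rmorphism K -> C}) (G : {poly {poly rat}}) (a x : K) :
  f (map_poly (horner_eval a \o map_poly (in_alg K)) G).[x] =
  (map_poly (eval_at (f a)) G).[f x].
Proof.
rewrite -horner_map -map_poly_comp /=; congr _.[_]; apply: eq_map_poly => q /=.
exact: rmorph_horner_rat.
Qed.

(** Fekete's argument; the bound holds at every embedding because the
    polynomial with root [b] is close to a power of ['X - z / 2] at every
    conjugate [z] of [alpha]. *)
Lemma exists_near_half (R : realType) (alpha : algC) (r : R[i]) (L : seq algC) :
    alpha \in Aint -> 1 < r ->
  exists b, [/\ b \in Aint, b \notin L &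
    forall (K : fieldExtType rat) (iota : {rmorphism K -> algC}) (x a : K),
      iota x = b -> iota a = alpha ->
      forall f : {rmorphism K -> R[i]}, `|f x - f a / 2| <= r].
Proof.
move=> alpha_int r_gt1.
have [p [_ p_monic] pP] := minCpolyP alpha.
have [rs] := closed_field_poly_normal (map_poly (ratr : rat -> R[i]) p).
rewrite (monicP _) ?map_monic // scale1r => rsE.
(* The second summand bounds the constant [k] chosen below; it must be accounted
   for in the choice of [m], on which [k] depends. *)
pose B := \sum_(z <- rs) \sum_(i < size p) `|z| ^+ i + (size L)%:R.
have sum_ge0 z : 0 <= \sum_(i < size p) `|z| ^+ i :> R[i].
  by rewrite sumr_ge0 // => i _; rewrite exprn_ge0.
have B_ge0 : 0 <= B by rewrite addr_ge0 // sumr_ge0.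
have [m Bm] := power_unbounded r_gt1 B_ge0.
have [N [G [e [mN G_monic szG G_int [eB pG]]]]] := int_near_power p_monic m.
pose Ga := map_poly (eval_at alpha) G.
(* Pigeonhole: [size L + 1] distinct constants, at most [size L] values. *)
have [k kL kP] : exists2 k, (k <= size L)%N & k%:R \notin [seq Ga.[l] | l <- L].
  set ks := iota 0 (size L).+1; set vs := [seq Ga.[l] | l <- L].
  have [/allP allk|] := boolP (all (fun k => k%:R \in vs) ks).
    have : (size [seq k%:R : algC | k <- ks] <= size vs)%N.
      apply: uniq_leq_size; last by move=> _ /mapP[k kI ->]; exact: allk.
      rewrite map_inj_uniq ?iota_uniq //; exact: (mulrIn (oner_neq0 _)).
    by rewrite !size_map size_iota ltnn.
  by case/allPn => k; rewrite mem_iota => /andP[_ kL] kP; exists k.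
have Ga_monic : Ga \is monic by exact: monic_map.
have szGa : size Ga = N.+1.
  rewrite -szG; apply: size_map_poly_id0.
  by rewrite (monicP G_monic) rmorph1 oner_neq0.
have sz_k : (size (- (k%:R%:P : {poly algC}))%R < size Ga)%N.
  rewrite size_polyN szGa (leq_ltn_trans (size_polyC_leq1 _)) // ltnS.
  exact: leq_ltn_trans mN.
have F_monic : Ga - k%:R%:P \is monic by rewrite monicE lead_coefDl -?monicE.
have [b Fb] : exists b, root (Ga - k%:R%:P) b.
  apply/closed_rootP; rewrite size_polyDl // szGa eqSS -lt0n.
  exact: leq_ltn_trans mN.
have Gb : Ga.[b] = k%:R.
  by move: Fb; rewrite rootE hornerD hornerN hornerC subr_eq0 => /eqP.
exists b; split.
- apply: root_monic_over_Aint F_monic _ Fb => j.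
  rewrite coefB coefC rpredB //; last first.
    by case: ifP => _; rewrite ?rpred0 ?rpred_nat.
  rewrite coef_map /= /eval_at /= /horner_eval horner_coef rpred_sum // => l _.
  rewrite coef_map rpredM ?rpredX //=.
  by have /intrP[u ->] := G_int j l; rewrite rmorph_int Aint_int.
- by apply: contra kP => bL; apply/mapP; exists b.
move=> K iota x a xb aa f.
have pfa : root (map_poly ratr p) (f a).
  rewrite rootE -rmorph_horner_rat fmorph_eq0 -(fmorph_eq0 iota).
  by rewrite rmorph_horner_rat aa -rootE pP dvdpp.
apply: (root_location (k := k) mN eB pG pfa r_gt1).
  apply: le_trans Bm; rewrite lerD ?ler_nat //.
  have frs : f a \in rs by rewrite -root_prod_XsubC -rsE.
  by rewrite (big_rem _ frs) /= lerDl sumr_ge0.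
rewrite -rmorph_eval_at -(rmorph_nat f); congr (f _).
by apply: (fmorph_inj iota); rewrite rmorph_eval_at xb aa rmorph_nat.
Qed.

(** * The inner product *)

Lemma minPoly_of_minCpoly (K : fieldExtType rat) (iota : {rmorphism K -> algC})
    (a : K) (p : {poly rat}) : p \is monic ->
    (forall q, root (map_poly ratr q) (iota a) = (p %| q)) ->
  map_poly (in_alg K) p = minPoly 1 a.
Proof.
move=> p_monic pP; have [q q_monic qE] := minPoly_ratP a.
have rootE r : root (map_poly (in_alg K) r) a = (p %| r).
  by rewrite -pP /root -rmorph_horner_rat fmorph_eq0.
rewrite -qE; congr map_poly; apply/eqP; rewrite -eqp_monic //.
by rewrite /eqp -{1}rootE qE root_minPoly -(root_minPoly_rat _ qE) rootE dvdpp.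
Qed.

(** Composition with complex conjugation permutes the embeddings. *)
Lemma embeddings_conj_sum (R : realType) (K : fieldExtType rat)
    (F : (K -> R[i]) -> R[i]) :
  \sum_(f \in embeddings R K) F (fun x => (f x)^*%C) =
  \sum_(f \in embeddings R K) F f.
Proof.
have [s [us _ sE]] := embeddings_enum R K.
have sP f : (f \in s) <-> embeddings R K f by rewrite -sE.
rewrite -sE -!fsbig_seq // -(big_map (fun f x => (f x)^*%C) predT F).
apply: perm_big; apply: uniq_perm => //.
  rewrite map_inj_uniq // => f g fg; apply/funext => x.
  by apply: (can_inj (@conjcK R)); have := congr1 (@^~ x) fg.
have conj_sub f : f \in s -> (fun x => (f x)^*%C) \in s.
  move=> /sP[g _ <-]; apply/sP.
  by exists ((@conjc R : {rmorphism R[i] -> R[i]}) \o g).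
move=> f; apply/mapP/idP => [[g gs ->]|fs]; first exact: conj_sub.
exists (fun x => (f x)^*%C); first exact: conj_sub.
by apply/funext => x; rewrite conjcK.
Qed.

Lemma polarization (R : realType) (u v : R[i]) :
  u * v^*%C + u^*%C * v = `|u + v| ^+ 2 / 2 - 2 * `|u - (u + v) / 2| ^+ 2.
Proof.
have -> : u - (u + v) / 2 = (u - v) / 2 by field.
rewrite normrM exprMn normfV normr_nat !sqr_normc rmorphD rmorphB /=.
by field.
Qed.

Lemma inner_self (R : realType) (a : algC) (p : {poly rat}) (rs : seq R[i]) :
    p \is monic -> (forall q, root (map_poly ratr q) a = (p %| q)) ->
    map_poly ratr p = \prod_(z <- rs) ('X - z%:P) ->
  inner R a a = (size rs)%:R^-1 * \sum_(z <- rs) `|z| ^+ 2.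
Proof.
move=> p_monic pP rsE.
have snd_fst : adjoin2_snd a a = adjoin2_fst a a.
  apply: (fmorph_inj (adjoin2_incl a a)).
  by rewrite adjoin2_incl_fst adjoin2_incl_snd.
have pE : map_poly (in_alg _) p = minPoly 1 (adjoin2_fst a a).
  apply: (@minPoly_of_minCpoly _ (adjoin2_incl a a)) => //.
  by rewrite adjoin2_incl_fst.
rewrite -(embedding_average (fun z => `|z| ^+ 2) pE rsE) /inner snd_fst.
by congr (_ * _); apply: eq_fsbigr => f _; rewrite sqr_normc.
Qed.

(** The sum defining [inner R b c] is invariant under conjugation, so it is half
    the sum of the terms [u * v^* + u^* * v], to which [polarization] applies;
    this also shows that [inner R b c] is real. *)
Lemma inner_lower_bound (R : realType) (b c : algC) (p : {poly rat})
    (rs : seq R[i]) (r : R[i]) :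
    p \is monic -> (forall q, root (map_poly ratr q) (b + c) = (p %| q)) ->
    map_poly ratr p = \prod_(z <- rs) ('X - z%:P) ->
    (forall f : {rmorphism adjoin2 b c -> R[i]},
      `|f (adjoin2_fst b c) - f (adjoin2_fst b c + adjoin2_snd b c) / 2|
        <= r) ->
  (size rs)%:R^-1 * (\sum_(z <- rs) `|z| ^+ 2) / 4 - r ^+ 2 <= inner R b c.
Proof.
move=> p_monic pP rsE near; rewrite /inner.
set K := adjoin2 b c in near *; set b' := adjoin2_fst b c in near *.
set c' := adjoin2_snd b c in near *; set n := \dim {: K}.
have pE : map_poly (in_alg _) p = minPoly 1 (b' + c').
  apply: (@minPoly_of_minCpoly _ (adjoin2_incl b c)) => //.
  by rewrite rmorphD adjoin2_incl_fst adjoin2_incl_snd.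
rewrite -(embedding_average (fun z => `|z| ^+ 2) pE rsE) -/n.
have [s [us szs sE]] := embeddings_enum R K.
have n_gt0 : 0 < n%:R :> R[i] by rewrite ltr0n adim_gt0.
set X := \sum_(f \in embeddings R K) _ * _.
have XE : X + X = \sum_(f <- s) (`|f (b' + c')| ^+ 2 / 2
    - 2 * `|f b' - f (b' + c') / 2| ^+ 2).
  rewrite -{2}[X]embeddings_conj_sum /X -sE -!fsbig_seq // -big_split /=.
  rewrite big_seq [RHS]big_seq; apply: eq_bigr => f fs; rewrite conjcK.
  have [g _ <-] : embeddings R K f by rewrite -sE.
  by rewrite polarization rmorphD.
have sumB : \sum_(f <- s) `|f b' - f (b' + c') / 2| ^+ 2 <= n%:R * r ^+ 2.
  rewrite /n -szs -sum1_size natr_sum mulr_suml big_seq [X in _ <= X]big_seq.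
  apply: ler_sum => f fs; rewrite mul1r.
  have [g _ <-] : embeddings R K f by rewrite -sE.
  have r_ge0 : 0 <= r := le_trans (normr_ge0 _) (near g).
  by rewrite lerXn2r ?nnegrE.
rewrite -sE -fsbig_seq //.
move: XE; rewrite sumrB -mulr_suml -mulr_sumr.
set S1 := \sum_(f <- s) _; set S2 := \sum_(f <- s) _ in sumB * => XE.
have -> : X = S1 / 4 - S2.
  have -> : X = (X + X) / 2 by field.
  by rewrite XE; field.
rewrite mulrBr mulrA lerB // ler_pdivrMl //.
Qed.

Theorem theorem1p2 (R : realType) (alpha : algC) (alpha_int : alpha \in Aint)
  (alpha_large : 4 < inner R alpha alpha) :
  infinite_set (decomposition R alpha).
Proof.
have [p [_ p_monic] pP] := minCpolyP alpha.
have [rs] := closed_field_poly_normal (map_poly (ratr : rat -> R[i]) p).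
rewrite (monicP _) ?map_monic // scale1r => rsE.
have innerE := inner_self p_monic pP rsE.
set r := sqrtC (inner R alpha alpha / 4).
have r2 : r ^+ 2 = inner R alpha alpha / 4 by rewrite sqrtCK.
have r_ge0 : 0 <= r.
  by rewrite sqrtC_ge0 divr_ge0 // ltW // (lt_trans _ alpha_large).
have r_gt1 : 1 < r.
  rewrite -(@ltr_pXn2r _ 2) ?nnegrE ?ler01 // expr1n r2 ltr_pdivlMr ?ltr0n //.
  by rewrite mul1r.
move=> /finite_seqP[s sE].
have [b [b_int bL near]] := exists_near_half (map fst s) alpha_int r_gt1.
have alphaE : alpha = b + (alpha - b) by rewrite addrC subrK.
suffices : (b, alpha - b) \in s.
  by move=> bs; case/negP: bL; apply/mapP; exists (b, alpha - b).
suffices : decomposition R alpha (b, alpha - b) by rewrite sE.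
split=> //=; first by rewrite rpredB.
have pP' q : root (map_poly ratr q) (b + (alpha - b)) = (p %| q).
  by rewrite -alphaE pP.
apply: le_trans (inner_lower_bound p_monic pP' rsE _ (r := r)).
  by rewrite -innerE r2 subrr.
move=> f; apply: (near _ (adjoin2_incl b (alpha - b))).
  exact: adjoin2_incl_fst.
by rewrite rmorphD adjoin2_incl_fst adjoin2_incl_snd -alphaE.
Qed.
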